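(* Let $T$ be a tetrahedron whose six edges carry the labelling symbols $x_1,\dots,x_6$, where the three pairs of opposite edges are $(x_1,x_4),(x_2,x_5),(x_3,x_6)$ and the four faces, each read anticlockwise as seen from outside $T$, are $$(x_1x_2x_3),\quad (x_2x_6x_4),\quad (x_3x_4x_5),\quad (x_1x_5x_6).$$ Consider the labellings of the edges by the integers $1,\dots,6$, each used exactly once. Then there are exactly forty eight coherent labellings of $T$ of this kind. They are those for which the cyclic word $(x_1x_2x_3x_4x_5x_6)$ (a word taken up to cyclic rotation of its six positions) belongs to the set $$\{(124635),(134625),(125634),(135624),(135246),(136245),(145236),(146235)\}.$$
   Context: Let the polyhedron be convex, with outward normal, so that each face $F$ is oriented and its boundary edges are traversed anticlockwise as seen by an observer outside the polyhedron. A labelling of all the edges by integers is coherent if, for each face $F$ with $n_F$ edges, there is a choice of starting edge such that the successive labels $a_1,a_2,\dots,a_{n_F}$ of the edges of $F$, read anticlockwise from that edge, satisfy $a_1<a_2<\cdots<a_{n_F}$. *)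

(* Defs.v *)
From mathcomp Require Export all_boot all_order all_algebra.

Set Implicit Arguments.
Unset Strict Implicit.
Unset Printing Implicit Defensive.

Import Order.TTheory GRing.Theory Num.Theory.

Local Open Scope ring_scope.

(* [reading F s] means: the edges of the face [F], read anticlockwise from
   some starting edge, are successively the items of [s].  A face with n edges
   thus has n readings, one for each starting edge. *)
Definition coherent (E F : Type) (reading : F -> seq E -> Prop)
    (L : E -> int) : Prop :=
  forall f : F, exists2 s, reading f s & sorted <%R (map L s).

(* The vertices of a tetrahedron are named by 'I_4; its edges and faces are
   the pairs and the triples of vertices. *)
Definition edge := {e : {set 'I_4} | #|e| == 2}.
Definition face := {F : {set 'I_4} | #|F| == 3}.

Record tetrahedron (R : realFieldType) := Tetrahedron {
  vertex :> 'I_4 -> 'rV[R]_3;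
  _ : row_free (\matrix_(i < 3) (vertex (lift ord0 i) - vertex ord0))
}.

(* The scalar triple product ((b - a) x (c - a)) . (d - a), coordinates being
   right-handed. *)
Definition triple (R : realFieldType) (a b c d : 'rV[R]_3) : R :=
  \det (\matrix_(i < 3) [:: b - a; c - a; d - a]`_i).

(* The normal (b - a) x (c - a) to the face abc is outward when the fourth
   vertex d lies on its negative side; a, b, c are then met in this order when
   going anticlockwise round the face, as seen from outside. *)
Definition anticlockwise (R : realFieldType) (T : tetrahedron R)
    (F : face) (s : seq edge) : Prop :=
  exists a b c d : 'I_4,
    [/\ uniq [:: a; b; c; d],
        val F = [set a; b; c],
        triple (T a) (T b) (T c) (T d) < 0
      & map val s = [:: [set a; b]; [set b; c]; [set c; a]]].

Definition opposite (e f : edge) : bool := [disjoint val e & val f].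

Definition labelling_1_6 (L : edge -> int) : Prop :=
  perm_eq (map L (enum {: edge})) [:: 1; 2; 3; 4; 5; 6].

Definition same_cyclic_word (A : Type) (s t : seq A) : Prop :=
  exists k : nat, t = rot k s.

Definition has_exactly (n : nat) (A : eqType) (P : A -> Prop) : Prop :=
  exists s : seq A, [/\ uniq s, size s = n & forall x, x \in s <-> P x].

Definition eight_words : seq (seq int) :=
  [:: [:: 1; 2; 4; 6; 3; 5]; [:: 1; 3; 4; 6; 2; 5];
      [:: 1; 2; 5; 6; 3; 4]; [:: 1; 3; 5; 6; 2; 4];
      [:: 1; 3; 5; 2; 4; 6]; [:: 1; 3; 6; 2; 4; 5];
      [:: 1; 4; 5; 2; 3; 6]; [:: 1; 4; 6; 2; 3; 5]].

(* Main.v *)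
Require Import Defs.
From mathcomp Require Import ring.
Set Implicit Arguments.
Unset Strict Implicit.
Unset Printing Implicit Defensive.

Import Order.TTheory GRing.Theory Num.Theory.

Local Open Scope ring_scope.

(** The scalar triple product of a, b, c, d changes sign when b and c are
    exchanged and is invariant under cyclic permutations of a, b, c.  A face of
    the tetrahedron with vertices a, b, c therefore has at most three
    anticlockwise readings, and they are the rotations of any one of them
    ([anticlockwise_rot]).  The four readings given in the theorem use
    different sets of edges, hence belong to four different faces; since a
    tetrahedron has only four faces and six edges, coherence of a labelling L
    depends only on the word L x1, ..., L x6, and says that along each of the
    four given readings the labels increase cyclically
    ([coherent_tetrahedronP]).

    Moreover L is determined by that word, which for labellings by 1, ..., 6
    is an arbitrary permutation of 1, ..., 6.  What remains is a finite
    statement about the 720 permutations, settled by evaluation: those meeting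
    the four cyclic conditions are the rotations of the eight words, and there
    are 48 of them. *)

(** * Counting in a finite type *)

Lemma mem_uniq_card (T : finType) (s : seq T) (x : T) :
  uniq s -> (#|T| <= size s)%N -> x \in s.
Proof.
move=> s_uniq s_size.
have s_enum : {subset s <= enum T} by move=> y _; rewrite mem_enum.
have [|_ ->] := uniq_min_size s_uniq s_enum; first by rewrite -cardE.
by rewrite mem_enum.
Qed.

Lemma card_draws_sig (T : finType) (k : nat) :
  #|{: {A : {set T} | #|A| == k}}| = 'C(#|T|, k).
Proof. by rewrite card_sig -card_draws cardsE. Qed.

Lemma card_edge : #|{: edge}| = 6%N.
Proof. by rewrite card_draws_sig card_ord. Qed.

Lemma card_face : #|{: face}| = 4%N.
Proof. by rewrite card_draws_sig card_ord. Qed.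

(** * Symmetries of the triple product *)

Lemma det_mx33 (R : comNzRingType) (A : 'M[R]_3) :
  \det A = A 0 0 * (A 1 1 * A 2 2 - A 1 2 * A 2 1)
         - A 0 1 * (A 1 0 * A 2 2 - A 1 2 * A 2 0)
         + A 0 2 * (A 1 0 * A 2 1 - A 1 1 * A 2 0).
Proof.
rewrite (expand_det_row A 0) !big_ord_recl big_ord0 /cofactor.
rewrite !(expand_det_row (_ : 'M_2) 0) !big_ord_recl !big_ord0 /cofactor.
rewrite !det_mx11 !mxE /=.
(* Indexing the entries by natural numbers lets the indices be computed. *)
have [f AE] : exists f : nat -> nat -> R, forall i j, A i j = f i j.
  by exists (fun m n => A (inord m) (inord n)) => i j; rewrite !inord_val.
by rewrite !AE /=; ring.
Qed.

Lemma triple_rot (R : realFieldType) (a b c d : 'rV[R]_3) :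
  triple b c a d = triple a b c d.
Proof.
rewrite /triple !det_mx33 !mxE.
move: (a 0 0) (a 0 1) (a 0 2) (b 0 0) (b 0 1) (b 0 2).
by move: (c 0 0) (c 0 1) (c 0 2) (d 0 0) (d 0 1) (d 0 2) => *; ring.
Qed.

Lemma triple_swap (R : realFieldType) (a b c d : 'rV[R]_3) :
  triple a c b d = - triple a b c d.
Proof.
rewrite /triple !det_mx33 !mxE.
move: (a 0 0) (a 0 1) (a 0 2) (b 0 0) (b 0 1) (b 0 2).
by move: (c 0 0) (c 0 1) (c 0 2) (d 0 0) (d 0 1) (d 0 2) => *; ring.
Qed.

(** * Anticlockwise readings of a face *)

Section Readings.
Variables (R : realFieldType) (T : tetrahedron R).

Lemma anticlockwise_rot1 (F : face) (s : seq edge) :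
  anticlockwise T F s -> anticlockwise T F (rot 1 s).
Proof.
move=> [a [b [c [d [abcd_uniq FE abcd_lt0 sE]]]]]; exists b, c, a, d; split.
- by rewrite -(perm_uniq (permEl (perm_catCA [:: a] [:: b; c] [:: d]))).
- by rewrite FE -setUA setUC.
- by rewrite triple_rot.
- by rewrite map_rot sE.
Qed.

(** A second reading of the same face is given by a permutation of the vertices
    a, b, c that preserves the sign of the triple product, that is, by a cyclic
    one. *)
Lemma anticlockwise_rot (F : face) (s t : seq edge) :
  anticlockwise T F s ->
  anticlockwise T F t <-> exists k, t = rot k s.
Proof.
move=> Fs; split=> [|[k ->]]; last first.
  have [k_le|/ltnW k_ge] := leqP k (size s); last by rewrite rot_oversize.
  elim: k k_le => [_|k IHk k_lt]; first by rewrite rot0.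
  by rewrite -addn1 addnC rotD //; apply/anticlockwise_rot1/IHk/ltnW.
case: Fs => a [b [c [d [s_uniq sF s_lt0 sE]]]].
case=> a' [b' [c' [d' [t_uniq tF t_lt0 tE]]]].
have memF i : i \in val F -> [\/ i = a, i = b | i = c].
  by rewrite sF !inE -orbA => /or3P[]/eqP->;
    [constructor 1 | constructor 2 | constructor 3].
have dE : d' = d.
  have d'F : d' \notin val F.
    rewrite tF !inE -!orbA; apply/negP=> /or3P[]/eqP d'E;
    by move: t_uniq; rewrite d'E /= !inE eqxx ?orbT ?andbF.
  have : d' \in [:: a; b; c; d] by apply: mem_uniq_card; rewrite ?card_ord.
  move: d'F; rewrite sF !inE -!orbA !negb_or.
  by move=> /and3P[/negPf-> /negPf-> /negPf->] /eqP.
suff [k tsE] : exists k, map val t = rot k (map val s).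
  by exists k; apply: (inj_map val_inj); rewrite map_rot.
have a'F : a' \in val F by rewrite tF !inE eqxx.
have b'F : b' \in val F by rewrite tF !inE eqxx orbT.
have c'F : c' \in val F by rewrite tF !inE eqxx orbT.
move: t_uniq t_lt0 tE; rewrite {}dE sE.
(* The odd permutations of a, b, c are excluded by the sign of the triple
   product. *)
have odd_ge0 : triple (T a) (T c) (T b) (T d) < 0 -> False.
  by rewrite triple_swap oppr_lt0 => /lt_trans/(_ s_lt0); rewrite ltxx.
case: (memF _ a'F) => ->; case: (memF _ b'F) => ->; case: (memF _ c'F) => -> //=;
  rewrite ?inE ?eqxx ?orbT ?andbF //= => _ t_lt0 ->;
  try (by exists 0%N); try (by exists 1%N); try (by exists 2%N);
  by case: odd_ge0; move: t_lt0; do ?rewrite -triple_rot //.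
Qed.

Lemma anticlockwise_mem (F : face) (s t : seq edge) :
  anticlockwise T F s -> anticlockwise T F t -> s =i t.
Proof. by move=> Fs /(anticlockwise_rot _ Fs)[k ->] x; rewrite mem_rot. Qed.

End Readings.

(** * Coherent words *)

(** Some rotation of the word abc is strictly increasing. *)
Definition cyclically_increasing (a b c : int) : bool :=
  [|| a < b < c, b < c < a | c < a < b].

Lemma cyclically_increasingP (A : Type) (L : A -> int) (x y z : A) :
  (exists k, sorted <%R (map L (rot k [:: x; y; z]))) <->
  cyclically_increasing (L x) (L y) (L z).
Proof.
split=> [[[|[|[|k]]]]|/or3P[]].
- by rewrite /= /cyclically_increasing andbT => ->.
- by rewrite /= /cyclically_increasing andbT => ->; rewrite orbT.
- by rewrite /= /cyclically_increasing andbT => ->; rewrite !orbT.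
- by rewrite rot_oversize //= /cyclically_increasing andbT => ->.
- by exists 0%N; rewrite /= andbT.
- by exists 1%N; rewrite /= andbT.
- by exists 2%N; rewrite /= andbT.
Qed.

(** The condition that coherence imposes on the word of the labels of
    x1, ..., x6, which are numbered from 0 in the word. *)
Definition coherent_word (w : seq int) : bool :=
  [&& cyclically_increasing w`_0 w`_1 w`_2,
      cyclically_increasing w`_1 w`_5 w`_3,
      cyclically_increasing w`_2 w`_3 w`_4
    & cyclically_increasing w`_0 w`_4 w`_5].

(** All the words that use each of 1, ..., 6 exactly once. *)
Definition words_1_6 : seq (seq int) := permutations [:: 1; 2; 3; 4; 5; 6].

Lemma size_coherent_words : size (filter coherent_word words_1_6) = 48%N.
Proof. by vm_compute. Qed.

Lemma coherent_wordP (w : seq int) : w \in words_1_6 ->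
  coherent_word w <-> exists2 v, v \in eight_words & same_cyclic_word v w.
Proof.
have /allP wordsP : all (fun w => coherent_word w ==
    (w \in [seq rot k v | k <- iota 0 6, v <- eight_words])) words_1_6.
  by vm_compute.
move=> /wordsP/eqP->; split=> [/allpairsP[[k v] /= [_ v8 ->]]|[v v8 [k ->]]].
  by exists v => //; exists k.
have v_size : size v = 6%N.
  have /allP/(_ v v8)/eqP // : all (fun v => size v == 6%N) eight_words.
  by [].
apply/allpairsP; have [k_lt|k_ge] := ltnP k 6; last first.
  by exists (0%N, v); rewrite rot_oversize ?v_size ?rot0.
by exists (k, v); rewrite mem_iota.
Qed.

(** * Labellings as words *)

Section LabellingWords.
Variable xs : seq edge.
Hypotheses (xs_uniq : uniq xs) (xs_size : size xs = 6%N).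

Lemma mem_edges (e : edge) : e \in xs.
Proof. by apply: mem_uniq_card; rewrite ?card_edge ?xs_size. Qed.

Lemma labelling_1_6P (L : edge -> int) :
  labelling_1_6 L <-> map L xs \in words_1_6.
Proof.
rewrite /labelling_1_6 mem_permutations.
have /(perm_map L)/permPl-> // : perm_eq (enum {: edge}) xs.
by apply: uniq_perm; rewrite ?enum_uniq // => e; rewrite mem_enum mem_edges.
Qed.

(** The labelling that gives to the successive edges of [xs] the successive
    items of [w]; as [mem_edges] shows, [xs] lists all the edges. *)
Definition labelling_of_word (w : seq int) : {ffun edge -> int} :=
  [ffun e => w`_(index e xs)].

Lemma map_labelling_of_word (w : seq int) :
  size w = 6%N -> map (labelling_of_word w) xs = w.
Proof.
move=> w_size; apply: (@eq_from_nth _ 0); rewrite size_map ?xs_size ?w_size //.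
have x0 : edge by case: xs xs_size.
by move=> i i_lt; rewrite (nth_map x0) ?xs_size // ffunE index_uniq ?xs_size.
Qed.

Lemma labelling_of_wordK (L : {ffun edge -> int}) :
  labelling_of_word (map L xs) = L.
Proof.
apply/ffunP=> e; rewrite ffunE (nth_map e) ?index_mem ?mem_edges //.
by rewrite nth_index ?mem_edges.
Qed.

Lemma has_exactly_labellings (p : pred (seq int)) :
  has_exactly (size (filter p words_1_6))
    (fun L : {ffun edge -> int} => labelling_1_6 L /\ p (map L xs)).
Proof.
have word_size w : w \in words_1_6 -> size w = 6%N.
  by rewrite mem_permutations => /perm_size.
exists (map labelling_of_word (filter p words_1_6)); split.
- rewrite map_inj_in_uniq ?filter_uniq ?permutations_uniq // => v w.
  rewrite !mem_filter => /andP[_ /word_size v6] /andP[_ /word_size w6] vw.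
  by rewrite -(map_labelling_of_word v6) vw map_labelling_of_word.
- by rewrite size_map.
move=> L; split=> [/mapP[w]|[/labelling_1_6P Lw pL]].
  rewrite mem_filter => /andP[pw w_in] ->; have w6 := word_size _ w_in.
  by rewrite labelling_1_6P map_labelling_of_word.
by apply/mapP; exists (map L xs); rewrite ?mem_filter ?pL ?labelling_of_wordK.
Qed.

End LabellingWords.

(** * Coherent labellings of the tetrahedron *)

(** The four readings belong to different faces, as any two of them have
    different sets of edges; so they account for all the faces. *)
Lemma coherent_tetrahedronP (R : realFieldType) (T : tetrahedron R)
    (x1 x2 x3 x4 x5 x6 : edge) (L : edge -> int) :
  uniq [:: x1; x2; x3; x4; x5; x6] ->
  (exists F, anticlockwise T F [:: x1; x2; x3]) ->
  (exists F, anticlockwise T F [:: x2; x6; x4]) ->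
  (exists F, anticlockwise T F [:: x3; x4; x5]) ->
  (exists F, anticlockwise T F [:: x1; x5; x6]) ->
  coherent (anticlockwise T) L <->
  coherent_word (map L [:: x1; x2; x3; x4; x5; x6]).
Proof.
move=> x_uniq [F1 r1] [F2 r2] [F3 r3] [F4 r4].
have faceP F x y z : anticlockwise T F [:: x; y; z] ->
    (exists2 s, anticlockwise T F s & sorted <%R (map L s)) <->
    cyclically_increasing (L x) (L y) (L z).
  move=> r; rewrite -cyclically_increasingP; split=> [[s]|[k k_sorted]].
    by move=> /(anticlockwise_rot _ r)[k ->]; exists k.
  by exists (rot k [:: x; y; z]) => //; apply/(anticlockwise_rot _ r); exists k.
have F_uniq : uniq [:: F1; F2; F3; F4].
  have neq F G s t x : anticlockwise T F s -> anticlockwise T G t ->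
      x \in s -> x \notin t -> F != G.
    move=> Fs Gt xs; apply: contraNneq => FG.
    by rewrite -FG in Gt; rewrite -(anticlockwise_mem Fs Gt).
  move: x_uniq; rewrite /= !inE !negb_or -!andbA.
  case/and5P=> n12 n13 n14 n15 /and5P[n16 n23 n24 n25 /and5P[n26 n34 n35 n36]].
  case/and4P=> n45 n46 n56 _.
  have F12 : F1 != F2.
    by apply: (neq _ _ _ _ x1 r1 r2); rewrite !inE ?eqxx // !negb_or n12 n16 n14.
  have F13 : F1 != F3.
    by apply: (neq _ _ _ _ x1 r1 r3); rewrite !inE ?eqxx // !negb_or n13 n14 n15.
  have F23 : F2 != F3.
    by apply: (neq _ _ _ _ x2 r2 r3); rewrite !inE ?eqxx // !negb_or n23 n24 n25.
  have F14 : F1 != F4.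
    apply: (neq _ _ _ _ x2 r1 r4); rewrite !inE ?eqxx ?orbT //.
    by rewrite !negb_or (eq_sym x2 x1) n12 n25 n26.
  have F42 : F4 != F2.
    by apply: (neq _ _ _ _ x1 r4 r2); rewrite !inE ?eqxx // !negb_or n12 n16 n14.
  have F43 : F4 != F3.
    by apply: (neq _ _ _ _ x1 r4 r3); rewrite !inE ?eqxx // !negb_or n13 n14 n15.
  by rewrite F12 F13 F14 F23 (eq_sym F2 F4) F42 (eq_sym F3 F4) F43.
split=> [cohL|/and4P[c1 c2 c3 c4] F].
  by apply/and4P; split; [have := cohL F1 | have := cohL F2 | have := cohL F3
    | have := cohL F4] => /faceP; apply.
have : F \in [:: F1; F2; F3; F4] by apply: mem_uniq_card; rewrite ?card_face.
by rewrite !inE => /or4P[]/eqP->; [apply/(faceP _ _ _ _ r1) |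
  apply/(faceP _ _ _ _ r2) | apply/(faceP _ _ _ _ r3) | apply/(faceP _ _ _ _ r4)].
Qed.

Theorem theorem2p1 (R : realFieldType) (T : tetrahedron R)
    (x1 x2 x3 x4 x5 x6 : edge)
    (x_uniq : uniq [:: x1; x2; x3; x4; x5; x6])
    (opp14 : opposite x1 x4) (opp25 : opposite x2 x5) (opp36 : opposite x3 x6)
    (face123 : exists F, anticlockwise T F [:: x1; x2; x3])
    (face264 : exists F, anticlockwise T F [:: x2; x6; x4])
    (face345 : exists F, anticlockwise T F [:: x3; x4; x5])
    (face156 : exists F, anticlockwise T F [:: x1; x5; x6]) :
  has_exactly 48 (fun L : {ffun edge -> int} =>
    labelling_1_6 L /\ coherent (anticlockwise T) L) /\
  (forall L : {ffun edge -> int}, labelling_1_6 L ->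
    (coherent (anticlockwise T) L <->
     exists2 w, w \in eight_words &
       same_cyclic_word w [:: L x1; L x2; L x3; L x4; L x5; L x6])).
Proof.
have cohP L := coherent_tetrahedronP L x_uniq face123 face264 face345 face156.
split=> [|L /(labelling_1_6P x_uniq erefl) Lw]; last first.
  by rewrite cohP; apply: coherent_wordP.
have [s [s_uniq s_size sP]] :=
  has_exactly_labellings x_uniq erefl coherent_word.
exists s; split=> [//||L]; first by rewrite s_size size_coherent_words.
by rewrite sP cohP.
Qed.
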